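(* Let $p\in(1,\infty)$ and let $\mu_0\in\mathbb{W}_p(\mathbb{R}^m)$ be absolutely continuous. Given $\{\theta_i\}_{i=1}^N\subset\Theta\subset\mathbb{R}^m$ and the corresponding measures $\mu_{\theta_i}=\mu_0(\cdot-\theta_i)\in\mathcal{M}^{\mathrm{trans}}(\mu_0,\Theta)$, $i=1,\dots,N$, the Functional Wassmap algorithm with exponent $p$ and embedding dimension $m$, applied to $\{\mu_{\theta_i}\}_{i=1}^N$, recovers $\{\theta_i\}_{i=1}^N$ up to rigid transformation.
   Context: $\mathbb{W}_p(\mathbb{R}^m)$ is the set of Borel probability measures $\mu$ on $\mathbb{R}^m$ with $\int|x|^p\,d\mu<\infty$, with the $p$-Wasserstein distance $W_p(\mu,\nu)=\inf_{\gamma}\left(\int_{\mathbb{R}^{2m}}|x-y|^p\,d\gamma(x,y)\right)^{1/p}$, the infimum being over all couplings $\gamma$ of $\mu$ and $\nu$; $|\cdot|$ is the Euclidean norm. Absolutely continuous means with respect to Lebesgue measure. The measure $\mu_0(\cdot-\theta)$ is $E\mapsto\mu_0(E-\theta)$, and for $\Theta\subset\mathbb{R}^m$, $\mathcal{M}^{\mathrm{trans}}(\mu_0,\Theta)=\{\mu_0(\cdot-\theta):\theta\in\Theta\}$. Functional Wassmap algorithm (exponent $p$, embedding dimension $d$). Input: measures $\mu_1,\dots,\mu_N\in\mathbb{W}_p(\mathbb{R}^m)$. (1) Form the $N\times N$ matrix $W$ with $W_{ij}=W_p(\mu_i,\mu_j)^2$. (2) Set $B=-\tfrac12 HWH$ with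 $H=I-\tfrac1N\mathbb{1}_N$, where $\mathbb{1}_N$ is the $N\times N$ all-ones matrix. (3) Take the truncated eigendecomposition $B_d=V_d\Lambda_dV_d^T$, where $\Lambda_d$ is the diagonal matrix of the $d$ largest eigenvalues of $B$ and the columns of $V_d$ are corresponding orthonormal eigenvectors (if $d>N$, pad with zero columns). (4) Output $z_i=$ the $i$-th row of $V_d\Lambda_d^{1/2}$, $i=1,\dots,N$, as points in $\mathbb{R}^d$. The algorithm recovers $\{y_i\}_{i=1}^N\subset\mathbb{R}^d$ up to rigid transformation if the eigenvalues in $\Lambda_d$ are nonnegative and, for any choice of eigenvectors, there is a Euclidean isometry $R(x)=Qx+b$ of $\mathbb{R}^d$ ($Q$ orthogonal) with $z_i=R(y_i)$ for all $i$. *)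

(* Defs.v *)
From HB Require Import structures.
From mathcomp Require Import all_boot all_order all_algebra.
From mathcomp Require Import all_classical all_reals all_analysis.

Set Implicit Arguments.
Unset Strict Implicit.
Unset Printing Implicit Defensive.

Import Order.TTheory GRing.Theory Num.Theory.
Import numFieldNormedType.Exports.

Local Open Scope classical_set_scope.
Local Open Scope ring_scope.

(* Points of R^m are row vectors. The library norm on matrices is the sup norm,
   so the Euclidean norm is defined explicitly; both induce the topology whose
   open sets generate the Borel sigma-algebra below. *)
Definition borel_rV (R : realType) (m : nat) :=
  g_sigma_algebraType (@open 'rV[R]_m).

Definition enorm (R : realType) (m : nat) (x : 'rV[R]_m) : R :=
  Num.sqrt (\sum_i x ord0 i ^+ 2).

(* Iterated product of the one-dimensional Lebesgue measure, transported along
   R * R^n ~ R^n.+1; a measure when restricted to Borel sets. *)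
Fixpoint lebesgue_rV (R : realType) (m : nat) : set (borel_rV R m) -> \bar R :=
  match m return set (borel_rV R m) -> \bar R with
  | 0 => \d_((0 : 'rV[R]_0) : borel_rV R 0)
  | n.+1 =>
      pushforward (lebesgue_measure \x @lebesgue_rV R n)%E
        (fun z : measurableTypeR R * borel_rV R n =>
           (row_mx (z.1 : R)%:M (z.2 : 'rV[R]_n) : borel_rV R n.+1))
  end.

Section translation.
Context {R : realType} {m : nat}.
Implicit Types (mu : probability (borel_rV R m) R) (theta : 'rV[R]_m).

Definition translate mu theta : set (borel_rV R m) -> \bar R :=
  fun E => mu [set (x : 'rV[R]_m) - theta | x in E].

Lemma translateE mu theta :
  translate mu theta =
  pushforward mu (fun x : borel_rV R m => (x : 'rV[R]_m) + theta : borel_rV R m).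
Proof.
apply/funext => E; rewrite /translate /pushforward; congr (mu _).
apply/seteqP; split => [_ [x Ex <-]|x Ex] /=; first by rewrite subrK.
by exists ((x : 'rV[R]_m) + theta) => //; rewrite addrK.
Qed.

Lemma measurable_translation theta :
  measurable_fun setT
    (fun x : borel_rV R m => (x : 'rV[R]_m) + theta : borel_rV R m).
Proof.
apply: (@measurability _ _ (borel_rV R m) (borel_rV R m) _ _ (@open 'rV[R]_m)) => // _ [A oA <-].
rewrite setTI; apply: sub_sigma_algebra.
have /continuousP cT : continuous (fun x : 'rV[R]_m => x + theta).
  by move=> x; apply: (@cvgD _ _ _ (nbhs x)); [exact: cvg_id|exact: cvg_cst].
exact: cT.
Qed.

Let translate0 mu theta : translate mu theta set0 = 0%E.
Proof. by rewrite /translate image_set0 measure0. Qed.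

Let translate_ge0 mu theta E : (0 <= translate mu theta E)%E.
Proof. exact: measure_ge0. Qed.

Let translate_sigma_additive mu theta : semi_sigma_additive (translate mu theta).
Proof.
rewrite translateE => F mF tF mUF; rewrite /pushforward preimage_bigcup.
have mT := measurable_translation theta.
apply: measure_semi_sigma_additive.
- by move=> n; rewrite -[X in measurable X]setTI; exact: mT.
- apply/trivIsetP => i j _ _ ij; rewrite -preimage_setI.
  by move/trivIsetP : tF => /(_ _ _ _ _ ij) ->//; rewrite preimage_set0.
- rewrite -preimage_bigcup -[X in measurable X]setTI.
  exact: mT.
Qed.

HB.instance Definition _ mu theta := isMeasure.Build _ _ _ (translate mu theta)
  (translate0 mu theta) (@translate_ge0 mu theta)
  (@translate_sigma_additive mu theta).

Let translate_setT mu theta : translate mu theta setT = 1%E.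
Proof. by rewrite translateE /pushforward preimage_setT probability_setT. Qed.

HB.instance Definition _ mu theta := Measure_isProbability.Build _ _ _
  (translate mu theta) (translate_setT mu theta).

End translation.

Section wasserstein.
Context {R : realType} {m : nat}.
Implicit Types (p : R) (mu nu : probability (borel_rV R m) R).

Definition wasserstein_space p : set (probability (borel_rV R m) R) :=
  [set mu : probability (borel_rV R m) R |
     (\int[mu]_x (enorm (x : 'rV[R]_m) `^ p)%:E < +oo)%E].

Definition couplings mu nu :
    set (probability (borel_rV R m * borel_rV R m)%type R) :=
  [set g | (forall A, measurable A -> g (A `*` setT) = mu A) /\
           (forall B, measurable B -> g (setT `*` B) = nu B)].

Definition ewasserstein p mu nu : \bar R :=
  ereal_inf
    [set ((\int[g]_z (enorm ((z.1 : 'rV[R]_m) - z.2) `^ p)%:E) `^ p^-1)%E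
    | g in couplings mu nu].

(* Finite, hence a faithful real value, on the Wasserstein space. *)
Definition wasserstein p mu nu : R := fine (ewasserstein p mu nu).

End wasserstein.

Section wassmap.
Context {R : realType}.

Definition wass_mx {m N : nat} (p : R)
    (mu : 'I_N -> probability (borel_rV R m) R) : 'M[R]_N :=
  \matrix_(i, j) wasserstein p (mu i) (mu j) ^+ 2.

Definition centering_mx (N : nat) : 'M[R]_N := 1%:M - N%:R^-1 *: const_mx 1.

Definition wassmap_mx {m N : nat} (p : R)
    (mu : 'I_N -> probability (borel_rV R m) R) : 'M[R]_N :=
  - 2^-1 *: (centering_mx N *m wass_mx p mu *m centering_mx N).

(* U is a full orthonormal basis of eigenvectors (as columns) with eigenvalues
   l, repeated with multiplicity, listed so that the first d are the d largest;
   no order is imposed among these. *)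
Definition eigendecomposition {N : nat} (d : nat) (B U : 'M[R]_N)
    (l : 'rV[R]_N) : Prop :=
  [/\ U^T *m U = 1%:M,
      B *m U = U *m diag_mx l &
      forall i j : 'I_N, (i < d <= j)%N -> l ord0 j <= l ord0 i].

(* The first d columns of A, padded with zero columns if N < d. *)
Definition trunc_cols {n N : nat} (d : nat) (A : 'M[R]_(n, N)) : 'M[R]_(n, d) :=
  \matrix_(i, k) oapp (A i) 0 (insub (k : nat) : option 'I_N).

Definition wassmap_embedding {N : nat} (d : nat) (U : 'M[R]_N) (l : 'rV[R]_N) :
    'M[R]_(N, d) :=
  trunc_cols d U *m diag_mx (map_mx Num.sqrt (trunc_cols d l)).

(* The action x |-> Q x on columns reads x *m Q^T on rows. *)
Definition wassmap_recovers {m N d : nat} (p : R)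
    (mu : 'I_N -> probability (borel_rV R m) R) (y : 'I_N -> 'rV[R]_d) : Prop :=
  forall (U : 'M[R]_N) (l : 'rV[R]_N),
    eigendecomposition d (wassmap_mx p mu) U l ->
    (forall k, 0 <= trunc_cols d l ord0 k) /\
    exists (Q : 'M[R]_d) (b : 'rV[R]_d),
      Q^T *m Q = 1%:M /\
      forall i, row i (wassmap_embedding d U l) = y i *m Q^T + b.

End wassmap.

(* Main.v *)
(* The translates satisfy W_p(mu_a, mu_b) = |a - b|: moving x + a to x + b costs
   exactly |a - b|^p, and for any coupling the tangent-line inequality
   |z|^p >= c^p + p c^(p-1) (<z, u> - c), with c = |a - b| and u = (a - b) / c,
   integrates to c^p because the mean of z = x - y is a - b for every coupling.
   Hence the matrix B is the Gram matrix Y Y^T of the centered parameters. Its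
   eigenvalues are nonnegative and at most m of them are nonzero, so the
   embedding Z satisfies Z Z^T = Y Y^T, and two families of vectors with the
   same Gram matrix differ by an orthogonal transformation. *)
Require Import Defs.
From HB Require Import structures.
From mathcomp Require Import all_boot all_order all_algebra.
From mathcomp Require Import all_classical all_reals all_analysis measurable_realfun.
From mathcomp Require Import ring lra.
Import Order.TTheory GRing.Theory Num.Theory.
Import numFieldNormedType.Exports.
Local Open Scope classical_set_scope.
Local Open Scope ring_scope.

(** * Inner product on row vectors, Cauchy-Schwarz and reflections *)

Definition dotp {R : realFieldType} {d : nat} (x y : 'rV[R]_d) : R :=
  (x *m y^T) ord0 ord0.

Section euclidean.
Context {R : realFieldType} {d : nat}.
Implicit Types x y z v : 'rV[R]_d.

Lemma dotpE x y : dotp x y = \sum_i x ord0 i * y ord0 i.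
Proof. by rewrite /dotp mxE; apply: eq_bigr => i _; rewrite mxE. Qed.

Lemma mulmx_dotp x y : x *m y^T = (dotp x y)%:M.
Proof. exact: mx11_scalar. Qed.

Lemma dotpC x y : dotp x y = dotp y x.
Proof. by rewrite !dotpE; apply: eq_bigr => i _; rewrite mulrC. Qed.

Lemma dotpBl x y z : dotp (x - y) z = dotp x z - dotp y z.
Proof. by rewrite /dotp mulmxBl !mxE. Qed.

Lemma dotpDl x y z : dotp (x + y) z = dotp x z + dotp y z.
Proof. by rewrite /dotp mulmxDl !mxE. Qed.

Lemma dotpBr x y z : dotp x (y - z) = dotp x y - dotp x z.
Proof. by rewrite !(dotpC x) dotpBl. Qed.

Lemma dotpZl a x y : dotp (a *: x) y = a * dotp x y.
Proof. by rewrite /dotp -scalemxAl mxE. Qed.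

Lemma dotpZr a x y : dotp x (a *: y) = a * dotp x y.
Proof. by rewrite dotpC dotpZl dotpC. Qed.

Lemma dotp_ge0 x : 0 <= dotp x x.
Proof. by rewrite dotpE sumr_ge0// => i _; rewrite -expr2 sqr_ge0. Qed.

Lemma dotp_eq0 x : dotp x x = 0 -> x = 0.
Proof.
rewrite dotpE => /eqP; rewrite psumr_eq0; last by move=> i _; rewrite -expr2 sqr_ge0.
move=> /allP x0; apply/rowP => i; rewrite mxE.
by have := x0 i (mem_index_enum i); rewrite mulf_eq0 orbb => /eqP.
Qed.

Lemma dotp_isometry (Q : 'M[R]_d) x y :
  Q *m Q^T = 1%:M -> dotp (x *m Q) (y *m Q) = dotp x y.
Proof. by move=> QQ; rewrite /dotp trmx_mul mulmxA -(mulmxA x) QQ mulmx1. Qed.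

(** Expanding the squared norm of [<y,y> x - <x,y> y] gives [<y,y>] times the difference of the two
    sides. *)
Lemma cauchy_schwarz x y : dotp x y ^+ 2 <= dotp x x * dotp y y.
Proof.
have [y0|yn0] := eqVneq (dotp y y) 0.
  by rewrite (dotp_eq0 _ y0) /dotp trmx0 !mulmx0 mxE expr0n mulr0.
have yy : 0 < dotp y y by rewrite lt_def yn0 dotp_ge0.
have := dotp_ge0 (dotp y y *: x - dotp x y *: y).
rewrite !dotpBl !dotpBr !dotpZl !dotpZr (dotpC y x).
set a := dotp x y; set b := dotp y y; set c := dotp x x => H.
suff : 0 <= b * (c * b - a ^+ 2) by rewrite pmulr_rge0// subr_ge0.
by move: H; congr (_ <= _); ring.
Qed.

(* For v = 0 the coefficient 2 / 0 is 0 and this is the identity. *)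
Definition reflection_mx v : 'M[R]_d := 1%:M - (2 / dotp v v) *: (v^T *m v).

Lemma mul_reflection x v : x *m reflection_mx v = x - (2 / dotp v v * dotp x v) *: v.
Proof.
by rewrite /reflection_mx mulmxBr mulmx1 -scalemxAr mulmxA mulmx_dotp mul_scalar_mx scalerA.
Qed.

(** A reflection is symmetric and its own inverse; the latter is checked on each basis row. *)
Lemma reflection_orthogonal v : reflection_mx v *m (reflection_mx v)^T = 1%:M.
Proof.
have -> : (reflection_mx v)^T = reflection_mx v.
  by rewrite /reflection_mx linearB /= linearZ /= trmx1 trmx_mul trmxK.
apply/row_matrixP => i; rewrite !rowE mulmxA !mul_reflection mulmx1.
rewrite dotpBl dotpZl -addrA -opprD -scalerDl.
have [v0|v0] := eqVneq (dotp v v) 0; first by rewrite v0 invr0 mulr0 !mul0r addr0 scale0r subr0.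
rewrite -[RHS]subr0; congr (_ - _).
by rewrite -[RHS](scale0r v); congr (_ *: _); field.
Qed.

Lemma reflection_fix x v : dotp x v = 0 -> x *m reflection_mx v = x.
Proof. by move=> xv; rewrite mul_reflection xv mulr0 scale0r subr0. Qed.

(** Equal norms give [<v,v> = 2 <x,v>] for [v = x - y], so the coefficient of [v] is 1 unless
    [v = 0], where [x = y] already. *)
Lemma reflection_swap x y : dotp x x = dotp y y -> x *m reflection_mx (x - y) = y.
Proof.
move=> xy; rewrite mul_reflection; set v := x - y.
have vv : dotp v v = 2 * dotp x v.
  by rewrite /v !dotpBl !dotpBr -xy (dotpC y x); ring.
have [v0|v0] := eqVneq (dotp v v) 0.
  by rewrite -[v in _ *: v]/(x - y) -/v (dotp_eq0 _ v0) scaler0 subr0;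
    apply/eqP; rewrite -subr_eq0 -/v (dotp_eq0 _ v0).
have -> : 2 / dotp v v * dotp x v = 1 by rewrite mulrAC -vv divff.
by rewrite scale1r /v opprB addrC subrK.
Qed.

End euclidean.

(** * Gram matrices determine vectors up to an orthogonal map *)

Lemma gramE {R : realFieldType} {N d : nat} (A : 'M[R]_(N, d)) i j :
  (A *m A^T) i j = dotp (row i A) (row j A).
Proof. by rewrite dotpE mxE; apply: eq_bigr => k _; rewrite !mxE. Qed.

(* Q is a product of reflections: once the first k rows agree, the reflection
   sending the current image of the next row of Y to the next row of Z fixes them. *)
Lemma gram_eq_orthogonal {R : realFieldType} {N d : nat} (Y Z : 'M[R]_(N, d)) :
  Y *m Y^T = Z *m Z^T ->
  exists Q : 'M[R]_d, Q^T *m Q = 1%:M /\ Z = Y *m Q^T.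
Proof.
move=> YZ.
have dYZ i j : dotp (row i Y) (row j Y) = dotp (row i Z) (row j Z).
  by rewrite -!gramE YZ.
suff /(_ N (leqnn N)) [Q [QQ YQ]] : forall n, (n <= N)%N -> exists Q : 'M[R]_d,
    Q *m Q^T = 1%:M /\ forall i : 'I_N, (i < n)%N -> row i Y *m Q = row i Z.
  exists Q^T; rewrite trmxK; split => //.
  by apply/row_matrixP => i; rewrite row_mul YQ.
elim=> [_|k IH kN]; first by exists 1%:M; rewrite trmx1 mulmx1; split.
have [Q [QQ YQ]] := IH (ltnW kN).
pose a := Ordinal kN; pose v := row a Y *m Q - row a Z.
exists (Q *m reflection_mx v); split.
  by rewrite trmx_mul mulmxA -(mulmxA Q) reflection_orthogonal mulmx1.
move=> i; rewrite ltnS leq_eqVlt mulmxA => /orP[/eqP ik|ik].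
  have -> : i = a by exact: val_inj.
  by rewrite reflection_swap// dotp_isometry.
rewrite (YQ _ ik) reflection_fix// dotpBr -(YQ _ ik) dotp_isometry// (YQ _ ik).
by rewrite dYZ subrr.
Qed.

(** * Euclidean norm and the tangent-line inequality for powers *)

Section enorm.
Context {R : realType} {m : nat}.
Implicit Types x y : 'rV[R]_m.

Lemma enormE x : enorm x = Num.sqrt (dotp x x).
Proof. by rewrite /enorm dotpE; congr Num.sqrt; apply: eq_bigr => i _; rewrite expr2. Qed.

Lemma enorm_ge0 x : 0 <= enorm x.
Proof. exact: sqrtr_ge0. Qed.

Lemma sqr_enorm x : enorm x ^+ 2 = dotp x x.
Proof. by rewrite enormE sqr_sqrtr// dotp_ge0. Qed.

Lemma norm_dotp_le x y : `|dotp x y| <= enorm x * enorm y.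
Proof.
rewrite -(ler_sqr (normr_ge0 _)) ?nnegrE ?mulr_ge0 ?enorm_ge0//.
by rewrite real_normK ?num_real// exprMn !sqr_enorm cauchy_schwarz.
Qed.

End enorm.

(** Young's inequality for [t] and [a^(p-1)] with the conjugate exponents [p] and [p/(p-1)],
    multiplied by [p]. *)
Lemma powR_tangent_le {R : realType} (p a t : R) : 1 < p -> 0 <= a -> 0 <= t ->
  p * a `^ (p - 1) * t <= t `^ p + (p - 1) * a `^ p.
Proof.
move=> p1 a0 t0.
have p0 : 0 < p by lra.
have q0 : 0 < p - 1 by lra.
have := @conjugate_powR R t (a `^ (p - 1)) p (p / (p - 1)) t0 (powR_ge0 _ _) p0 (divr_gt0 p0 q0).
rewrite -powRrM mulrCA divff ?gt_eqF// mulr1 => H.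
have {}H : t * a `^ (p - 1) <= t `^ p / p + a `^ p / (p / (p - 1)).
  by apply: H; rewrite invf_div -[X in X + _]mul1r -mulrDl addrC subrK divff// gt_eqF.
have := ler_wpM2l (ltW p0) H; congr (_ <= _); first by ring.
by field; rewrite !gt_eqF.
Qed.

(** * Borel measurability of coordinates and transport costs *)

Section measurability.
Context {R : realType} {m : nat}.

Lemma measurable_coord i : measurable_fun setT (fun x : borel_rV R m => (x : 'rV[R]_m) ord0 i).
Proof.
apply: (measurability _ (RGenOpens.measurableE R)) => //.
move=> _ [_ [a [b ->] <-]]; rewrite setTI; apply: sub_sigma_algebra.
by have /continuousP := @coord_continuous R 1 m ord0 i; apply; exact: interval_open.
Qed.

Lemma measurable_dotpl v : measurable_fun setT (fun x : borel_rV R m => dotp (x : 'rV[R]_m) v).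
Proof.
under eq_fun do rewrite dotpE.
by apply: measurable_sum => i; apply: measurable_funM => //; exact: measurable_coord.
Qed.

Lemma measurable_enorm_powR (p : R) :
  measurable_fun setT (fun x : borel_rV R m => enorm (x : 'rV[R]_m) `^ p).
Proof.
apply: (measurableT_comp (measurable_powR _)).
rewrite /enorm; apply: (measurableT_comp (continuous_measurable_fun (@sqrt_continuous R))).
by apply: measurable_sum => i; apply: measurable_funX; exact: measurable_coord.
Qed.

Lemma measurable_cost (p : R) : measurable_fun setT
  (fun z : borel_rV R m * borel_rV R m => enorm ((z.1 : 'rV[R]_m) - z.2) `^ p).
Proof.
apply: (measurableT_comp (measurable_powR _)).
rewrite /enorm; apply: (measurableT_comp (continuous_measurable_fun (@sqrt_continuous R))).
apply: measurable_sum => i; apply: measurable_funX; under eq_fun do rewrite !mxE.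
by apply: measurable_funB; apply: (measurableT_comp (measurable_coord i)).
Qed.

End measurability.

(** * Integrals depending only on a push-forward *)

Lemma integral_probability_cst {d : measure_display} {T : measurableType d} {R : realType}
    (P : probability T R) (r : R) : (\int[P]_x r%:E = r%:E)%E.
Proof.
by rewrite [LHS](integral_cst P measurableT) [X in (_ * X)%E]probability_setT mule1.
Qed.

Section same_pushforward.
Context {d1 d2 d : measure_display} {T1 : measurableType d1} {T2 : measurableType d2}
  {T : measurableType d} {R : realType}.
Variables (mu1 : measure T1 R) (mu2 : measure T2 R) (f1 : T1 -> T) (f2 : T2 -> T).
Hypotheses (mf1 : measurable_fun setT f1) (mf2 : measurable_fun setT f2).
Hypothesis mu12 : forall A, measurable A -> mu1 (f1 @^-1` A) = mu2 (f2 @^-1` A).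

Let integral_eq (h : T -> \bar R) :
  (\int[pushforward mu1 f1]_x h x = \int[pushforward mu2 f2]_x h x)%E.
Proof. by apply: eq_measure_integral => // A mA _; exact: mu12. Qed.

Variables (h : T -> R).
Hypotheses (mh : measurable_fun setT h) (ih : mu2.-integrable setT (fun x => (h (f2 x))%:E)).

(** Serves to move integrals of one coordinate of a coupling to the base measure, where that
    coordinate has the law of a shifted point. *)
Lemma same_pushforward_integrable : mu1.-integrable setT (fun x => (h (f1 x))%:E).
Proof.
have mEh : measurable_fun setT (EFin \o h) by exact/measurable_EFinP.
apply/integrableP; split; first exact: measurableT_comp mEh mf1.
have mAh : measurable_fun setT (fun x => `|(h x)%:E|%E) by exact: measurableT_comp.
have := ge0_integral_pushforward mf1 mu1 measurableT mAh (fun _ _ => abse_ge0 _).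
have := ge0_integral_pushforward mf2 mu2 measurableT mAh (fun _ _ => abse_ge0 _).
rewrite integral_eq => -> /= <-.
by case/integrableP : ih.
Qed.

Lemma same_pushforward_integral :
  (\int[mu1]_x (h (f1 x))%:E = \int[mu2]_x (h (f2 x))%:E)%E.
Proof.
have mEh : measurable_fun setT (EFin \o h) by exact/measurable_EFinP.
have := integral_pushforward mf1 mEh same_pushforward_integrable measurableT.
by rewrite integral_eq (integral_pushforward mf2 mEh ih measurableT) => <-.
Qed.

End same_pushforward.

(** * Wasserstein distance between translates *)

Section translates.
Context {R : realType} {m : nat} (p : R) (mu : probability (borel_rV R m) R).
Hypotheses (p1 : 1 < p) (Wmu : wasserstein_space p mu).
Local Notation E := 'rV[R]_m.

Let p0 : 0 < p. Proof. exact: lt_trans ltr01 p1. Qed.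

(** The tangent-line inequality at 1 reads [p t <= t^p + (p - 1)], so with Cauchy-Schwarz the finite
    [p]-th moment dominates every linear form. *)
Lemma integrable_dotp (v : E) :
  mu.-integrable setT (fun x : borel_rV R m => (dotp (x : E) v)%:E).
Proof.
have icost : mu.-integrable setT (fun x : borel_rV R m => (enorm (x : E) `^ p)%:E).
  apply/integrableP; split; first by apply/measurable_EFinP; exact: measurable_enorm_powR.
  by under eq_integral do rewrite gee0_abs ?lee_fin ?powR_ge0//; exact: Wmu.
have ione := finite_measure_integrable_cst mu (p - 1) measurableT.
have := integrableZl measurableT (enorm v / p) (integrableD measurableT icost ione).
apply: le_integrable => //; first by apply/measurable_EFinP; exact: measurable_dotpl.
move=> x _ /=; rewrite lee_fin.
have := @powR_tangent_le R p 1 (enorm (x : E)) p1 ler01 (enorm_ge0 _).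
rewrite !powR1 !mulr1 => H.
rewrite (le_trans (norm_dotp_le _ _))// ger0_norm; last first.
  by rewrite mulr_ge0 ?divr_ge0 ?enorm_ge0 ?(ltW p0)// addr_ge0 ?powR_ge0// subr_ge0 ltW.
by rewrite mulrC -mulrA ler_wpM2l ?enorm_ge0// ler_pdivlMl.
Qed.

Lemma integrable_dotp_shift (a v : E) :
  mu.-integrable setT (fun x : borel_rV R m => (dotp ((x : E) + a) v)%:E).
Proof.
under eq_fun do rewrite dotpDl EFinD.
exact: integrableD (integrable_dotp v) (finite_measure_integrable_cst mu _ measurableT).
Qed.

Lemma integral_dotp_shift (a v : E) :
  (\int[mu]_x (dotp ((x : E) + a) v)%:E = \int[mu]_x (dotp (x : E) v)%:E + (dotp a v)%:E)%E.
Proof.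
under eq_integral do rewrite dotpDl EFinD.
rewrite integralD_EFin//; first last.
- exact: (finite_measure_integrable_cst mu _ measurableT).
- exact: integrable_dotp.
congr (_ + _)%E.
exact: integral_probability_cst.
Qed.

Lemma coupling_cost_ge (a b : E) g :
  couplings (translate mu a) (translate mu b) g ->
  ((enorm (a - b) `^ p)%:E <= \int[g]_z (enorm ((z.1 : E) - z.2) `^ p)%:E)%E.
Proof.
move=> [g1 g2]; set v := a - b; set c := enorm v.
have c0 : 0 <= c := enorm_ge0 v.
have cost_ge0 z : (0 <= (enorm ((z.1 : E) - z.2 : E) `^ p)%:E :> \bar R)%E.
  by rewrite lee_fin powR_ge0.
(* The case [c = 0] is split off because the slope [k] below divides by [c]; there the bound is
   0. *)
have [cz|cn0] := eqVneq c 0.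
  by rewrite cz powR0 ?gt_eqF// integral_ge0.
have {cn0} c_gt0 : 0 < c by rewrite lt_def cn0.
have mv := @measurable_dotpl R m v.
(* The marginal conditions say that the coordinates under [g] have the laws of [x + a] and [x + b]
   under [mu]. *)
have h1 A : measurable A ->
    g (fst @^-1` A) = mu ((fun x : borel_rV R m => (x : E) + a : borel_rV R m) @^-1` A).
  by move=> mA; rewrite -[RHS]/(pushforward mu _ A) -translateE -g1// setXT.
have h2 A : measurable A ->
    g (snd @^-1` A) = mu ((fun x : borel_rV R m => (x : E) + b : borel_rV R m) @^-1` A).
  by move=> mA; rewrite -[RHS]/(pushforward mu _ A) -translateE -g2// setTX.
have i1 := same_pushforward_integrable _ _ _ _
  measurable_fst (measurable_translation a) h1 _ mv (integrable_dotp_shift a v).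
have i2 := same_pushforward_integrable _ _ _ _
  measurable_snd (measurable_translation b) h2 _ mv (integrable_dotp_shift b v).
have e1 := same_pushforward_integral _ _ _ _
  measurable_fst (measurable_translation a) h1 _ mv (integrable_dotp_shift a v).
have e2 := same_pushforward_integral _ _ _ _
  measurable_snd (measurable_translation b) h2 _ mv (integrable_dotp_shift b v).
(* An infinite cost satisfies the bound trivially; a finite one makes the cost integrable, as
   comparing real-valued integrals requires. *)
have [->|goo] := eqVneq (\int[g]_z (enorm ((z.1 : E) - z.2) `^ p)%:E)%E +oo%E.
  by rewrite leey.
have icost : g.-integrable setT (fun z => (enorm ((z.1 : E) - z.2) `^ p)%:E).
  apply/integrableP; split; first by apply/measurable_EFinP; exact: measurable_cost.
  by under eq_integral do rewrite gee0_abs//; rewrite ltey.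
(* Slope [p c^(p-1)] of the tangent at [c], divided by [c] to normalise the direction [v]. *)
pose k := p * c `^ (p - 1) / c.
have kcc : k * dotp v v = p * c `^ p.
  rewrite -sqr_enorm -/c /k expr2 mulrA divfK ?gt_eqF// -mulrA; congr (_ * _).
  by rewrite mulrC mulr_powRB1.
have k0 : 0 <= k by rewrite /k !mulr_ge0 ?powR_ge0 ?invr_ge0// ltW.
have ilhs := integrableZl measurableT k (integrableB measurableT i1 i2).
pose K := (p - 1) * c `^ p.
have icst := finite_measure_integrable_cst g K measurableT.
have irhs := integrableD measurableT icost icst.
have := le_integral measurableT ilhs irhs.
rewrite integralZl//; last exact: integrableB i1 i2.
rewrite integralB_EFin// e1 e2 !integral_dotp_shift integralD_EFin//.
have -> : (\int[g]_x (EFin \o cst K) x = K%:E)%E.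
  exact: integral_probability_cst.
have /fineK <- := integrable_fin_num measurableT (integrable_dotp v).
have /fineK <- := integrable_fin_num measurableT icost.
set I := fine _; set J := fine _; rewrite -!EFinD -EFinM !lee_fin.
(* The mean [I] of [<x,v>] under [mu] cancels, so the linear side is the same for every coupling;
   [J] is the cost. *)
have -> : k * (I + dotp a v - (I + dotp b v)) = p * c `^ p.
  by rewrite -kcc /v dotpBl; ring.
move=> H; suff : p * c `^ p <= J + K by rewrite /K; lra.
(* Pointwise, Cauchy-Schwarz gives [k <z,v> <= p c^(p-1) |z|] for the difference [z] of the two
   coordinates, and the tangent-line inequality finishes. *)
apply: H => z _ /=; rewrite -EFinB -EFinM -EFinD lee_fin -dotpBl.
apply: le_trans (powR_tangent_le _ _ _ p1 c0 (enorm_ge0 _)).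
rewrite /k -(mulrA (p * _) c^-1) ler_wpM2l ?mulr_ge0 ?powR_ge0 ?(ltW p0)//.
rewrite ler_pdivrMl// mulrC; apply: le_trans (norm_dotp_le _ _); exact: ler_norm.
Qed.

(** The witness is the law of [(x + a, x + b)] under [mu]: the difference of its coordinates is
    constantly [a - b]. *)
Lemma coupling_cost_translate (a b : E) :
  exists2 g, couplings (translate mu a) (translate mu b) g &
    (\int[g]_z (enorm ((z.1 : E) - z.2) `^ p)%:E = (enorm (a - b) `^ p)%:E)%E.
Proof.
pose f (x : borel_rV R m) : borel_rV R m * borel_rV R m := ((x : E) + a, (x : E) + b).
have mf : measurable_fun setT f.
  by apply: measurable_fun_pair; exact: measurable_translation.
pose F : {mfun borel_rV R m >-> (borel_rV R m * borel_rV R m)%type} :=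
  HB.pack f (isMeasurableFun.Build _ _ _ _ f mf).
exists (distribution mu F).
  split => A mA; rewrite ?setXT ?setTX; congr (mu _); apply/seteqP; split => x /=.
  - by move=> Ax; exists ((x : E) + a) => //; rewrite addrK.
  - by move=> [y Ay <-]; rewrite subrK.
  - by move=> Ax; exists ((x : E) + b) => //; rewrite addrK.
  - by move=> [y Ay <-]; rewrite subrK.
rewrite ge0_integral_distribution//=.
- under eq_integral do rewrite opprD addrACA subrr add0r.
  exact: integral_probability_cst.
- by apply/measurable_EFinP; exact: measurable_cost.
- by move=> z; rewrite lee_fin powR_ge0.
Qed.

Lemma wasserstein_translate (a b : E) :
  wasserstein p (translate mu a) (translate mu b) = enorm (a - b).
Proof.
have root : (((enorm (a - b) `^ p)%:E `^ p^-1) = (enorm (a - b))%:E)%E.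
  by rewrite poweR_EFin -powRrM divff ?gt_eqF// powRr1// enorm_ge0.
suff : ewasserstein p (translate mu a) (translate mu b) = (enorm (a - b))%:E.
  by rewrite /wasserstein => ->.
apply/eqP; rewrite eq_le; apply/andP; split.
- have [g gab gE] := coupling_cost_translate a b.
  by rewrite -root -gE; apply: ereal_inf_lbound; exists g.
- apply: le_ereal_inf_tmp => _ [g gab <-]; rewrite -root.
  apply: gt0_ler_poweR (coupling_cost_ge _ _ _ gab).
  + by rewrite invr_ge0 ltW.
  + by rewrite in_itv /= leey lee_fin powR_ge0.
  + by rewrite in_itv /= leey integral_ge0// => z _; rewrite lee_fin powR_ge0.
Qed.

End translates.

(** * Truncated spectral factorisation of a Gram matrix *)

(** Terms at indices from [minn d N] on vanish on both sides, by padding or by hypothesis; this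
    treats truncation and zero padding together. *)
Lemma sum_oapp_insub {V : nmodType} (d N : nat) (F : 'I_N -> V) :
  (forall k : 'I_N, (d <= k)%N -> F k = 0) ->
  \sum_(k < d) oapp F 0 (insub (k : nat)) = \sum_k F k.
Proof.
move=> F0; pose G n := oapp F 0 (insub n).
have -> : \sum_k F k = \sum_(k < N) G k.
  by apply: eq_bigr => k _; rewrite /G valK.
rewrite -(big_mkord xpredT G) -(big_mkord xpredT G).
have G0 n : (minn d N <= n)%N -> G n = 0.
  rewrite geq_min /G; case: insubP => //= k kN <-.
  by rewrite (leqNgt N) ltn_ord orbF; exact: F0.
have sum0 a b : (minn d N <= a)%N -> \sum_(a <= k < b) G k = 0.
  by move=> dNa; rewrite big_nat big1// => k /andP[/(leq_trans dNa) + _]; exact: G0.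
have [dN|Nd] := leqP d N.
- by rewrite [RHS](big_cat_nat (n := d))//= (sum0 d) ?addr0// (minn_idPl dN).
- rewrite [LHS](big_cat_nat (n := N))//= ?(ltnW Nd)//.
  by rewrite (sum0 N) ?addr0// geq_minr.
Qed.

Section gram.
Context {R : realType} {N d : nat}.
Variables (Y : 'M[R]_(N, d)) (U : 'M[R]_N) (l : 'rV[R]_N).
Hypothesis UlP : eigendecomposition d (Y *m Y^T) U l.

(** In the eigenbasis the rows of [U^T *m Y] are orthogonal, and their squared norms are the
    eigenvalues. *)
Let UY : (U^T *m Y) *m (U^T *m Y)^T = diag_mx l.
Proof.
by case: UlP => UU BU _; rewrite trmx_mul trmxK mulmxA -(mulmxA _ Y) -mulmxA BU mulmxA UU mul1mx.
Qed.

Lemma gram_eigenvalue_ge0 k : 0 <= l ord0 k.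
Proof.
have /matrixP/(_ k k) := UY; rewrite [in RHS]mxE eqxx mulr1n => <-.
by rewrite mxE sumr_ge0// => i _; rewrite [_^T _ _]mxE -expr2 sqr_ge0.
Qed.

(* If l_j > 0 then so are the d eigenvalues dominating it, and U^T Y would have
   d + 1 nonzero orthogonal rows of width d. *)
Lemma gram_eigenvalue_eq0 (j : 'I_N) : (d <= j)%N -> l ord0 j = 0.
Proof.
move=> dj; apply/eqP; apply: contraT => lj0.
have lj : 0 < l ord0 j by rewrite lt_def lj0 gram_eigenvalue_ge0.
have dN : (d <= N)%N := leq_trans dj (ltnW (ltn_ord j)).
(* Here [insub] lands in ['I_d]: indices below [d] keep their value and the last one goes to [j]. *)
pose f (i : 'I_d.+1) : 'I_N := oapp (widen_ord dN) j (insub (i : nat)).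
have f_inj : injective f.
  move=> x y; rewrite /f; case: insubP => [x' _ /= xx'|]; case: insubP => [y' _ /= yy'|].
  - by move=> /(congr1 val) /= xy; apply: val_inj; rewrite /= -xx' -yy'.
  - by move=> _ /(congr1 val) /= xy; have := ltn_ord x'; rewrite xy ltnNge dj.
  - by move=> _ /(congr1 val) /= xy; have := ltn_ord y'; rewrite -xy ltnNge dj.
  - rewrite -!leqNgt => dy dx _; apply: val_inj => /=; apply/eqP.
    by rewrite eqn_leq (leq_trans _ dy) ?(leq_trans _ dx)// -ltnS.
have lf i : 0 < l ord0 (f i).
  rewrite /f; case: insubP => [x' _ /= xx'|_] //=.
  by case: UlP => _ _ /(_ (widen_ord dN x') j) H;
    apply: (lt_le_trans lj); apply: H; rewrite /= ltn_ord.
pose A := rowsub f (U^T *m Y).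
have AA : A *m A^T = diag_mx (\row_i l ord0 (f i)).
  apply/matrixP => a b; rewrite !mxE.
  have /matrixP/(_ (f a) (f b)) := UY; rewrite !mxE (inj_eq f_inj) => <-.
  by apply: eq_bigr => k _; rewrite !mxE.
have : A *m A^T \in unitmx.
  rewrite AA unitmxE det_diag unitfE; apply/prodf_neq0 => i _.
  by rewrite mxE gt_eqF.
move=> /mxrank_unit rA; have := mxrankM_maxl A A^T.
by rewrite rA => /leq_trans/(_ (rank_leq_col A)); rewrite ltnn.
Qed.

Lemma trunc_eigenvalue_ge0 k : 0 <= trunc_cols d l ord0 k.
Proof. by rewrite mxE; case: insub => //= i; exact: gram_eigenvalue_ge0. Qed.

(** Truncation loses nothing because the dropped eigenvalues are zero, and the square roots
    recombine because the kept ones are nonnegative. *)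
Lemma wassmap_embedding_gram :
  wassmap_embedding d U l *m (wassmap_embedding d U l)^T = Y *m Y^T.
Proof.
have [UU BU _] := UlP.
have -> : Y *m Y^T = U *m diag_mx l *m U^T.
  by rewrite -BU -mulmxA (mulmx1C UU) mulmx1.
rewrite /wassmap_embedding; set D := diag_mx (map_mx _ _).
rewrite trmx_mul tr_diag_mx mulmxA -(mulmxA _ D D) mulmx_diag.
apply/matrixP => i j; rewrite !mul_mx_diag !mxE.
rewrite -[RHS](@sum_oapp_insub _ d) => [|k dk]; last first.
  by rewrite !mxE gram_eigenvalue_eq0// mulr0 mul0r.
apply: eq_bigr => k _; rewrite !mxE -expr2 sqr_sqrtr; last first.
  by have := trunc_eigenvalue_ge0 k; rewrite mxE.
by case: insubP => [a _ _|_] /=; rewrite ?mulr0// !mxE.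
Qed.

End gram.

(** * Double centering of squared distances *)

Section centering.
Context {R : realType} {N : nat}.
Local Notation H := (@centering_mx R N).

Lemma centering_sym : H^T = H.
Proof. by rewrite /centering_mx linearB /= linearZ /= trmx1 trmx_const. Qed.

Lemma centering_const : H *m (const_mx 1 : 'cV_N) = 0.
Proof.
apply/matrixP => i j; rewrite /centering_mx mulmxBl mul1mx -scalemxAl !mxE.
under eq_bigr do rewrite !mxE mulr1.
(* The row index [i] itself witnesses that [N] is positive. *)
have N0 : (N%:R : R) != 0 by rewrite pnatr_eq0 -lt0n (leq_ltn_trans _ (ltn_ord i)).
by rewrite sumr_const card_ord mulVf// subrr.
Qed.

(** The polarization identity behind classical multidimensional scaling: squared distances form
    [s e^T + e s^T - 2 X X^T], and centering kills both terms containing [e]. *)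
Lemma centering_sqdist {d : nat} (X : 'M[R]_(N, d)) :
  - 2^-1 *: (H *m (\matrix_(i, j) dotp (row i X - row j X) (row i X - row j X)) *m H)
  = (H *m X) *m (H *m X)^T.
Proof.
pose s : 'cV[R]_N := \col_i dotp (row i X) (row i X).
pose e : 'cV[R]_N := const_mx 1.
have -> : (\matrix_(i, j) dotp (row i X - row j X) (row i X - row j X)) =
    s *m e^T + e *m s^T - 2 *: (X *m X^T).
  have -> : X *m X^T = \matrix_(i, j) dotp (row i X) (row j X).
    by apply/matrixP => i j; rewrite gramE mxE.
  apply/matrixP => i j; rewrite !mxE !big_ord1 !mxE mulr1 mul1r.
  rewrite !dotpBl !dotpBr (dotpC (row j X) (row i X)).
  by ring.
have He : H *m e = 0 := centering_const.
(* From here only the symmetry of the centering matrix and its vanishing on [e] matter. *)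
have Hs := centering_sym; move: H He Hs => K Ke Ks.
have eK : e^T *m K = 0 by rewrite -Ks -trmx_mul Ke trmx0.
rewrite mulmxBr mulmxDr !mulmxBl !mulmxDl (mulmxA _ e) Ke !mul0mx.
rewrite -!mulmxA eK !mulmx0 addr0 sub0r -!scalemxAl -!scalemxAr scalerN scaleNr opprK.
by rewrite scalerA mulVf ?pnatr_eq0// scale1r trmx_mul Ks !mulmxA.
Qed.

(** The subtracted vector is the mean of the rows, the same for all [i]; it yields the translation
    part of the isometry. *)
Lemma row_centering {d : nat} (X : 'M[R]_(N, d)) i :
  row i (H *m X) = row i X - N%:R^-1 *: (const_mx 1 *m X).
Proof.
rewrite /centering_mx mulmxBl mul1mx -scalemxAl linearB /= linearZ /= row_mul.
by congr (_ - _ *: (_ *m _)); apply/rowP => k; rewrite !mxE.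
Qed.

End centering.

(** * Recovery from Euclidean distances, applied to translates *)

Lemma wassmap_recovers_sqdist {R : realType} {m N d : nat} (p : R)
    (mu : 'I_N -> probability (borel_rV R m) R) (y : 'I_N -> 'rV[R]_d) :
  (forall i j, wasserstein p (mu i) (mu j) ^+ 2 = dotp (y i - y j) (y i - y j)) ->
  wassmap_recovers p mu y.
Proof.
move=> Wy U l; pose X : 'M[R]_(N, d) := \matrix_i y i.
have -> : wassmap_mx p mu = (centering_mx N *m X) *m (centering_mx N *m X)^T.
  rewrite -centering_sqdist /wassmap_mx; congr (_ *: (_ *m _ *m _)).
  by apply/matrixP => i j; rewrite !mxE !rowK Wy.
move=> UlP; split; first exact: trunc_eigenvalue_ge0 _ _ _ UlP.
have [Q [QQ ZQ]] := gram_eq_orthogonal _ _ (esym (wassmap_embedding_gram _ _ _ UlP)).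
(* The translation undoes the centering: it is minus the mean of the points, carried by [Q]. *)
exists Q, (- (N%:R^-1 *: (const_mx 1 *m X) *m Q^T)); split => // i.
by rewrite ZQ row_mul row_centering rowK mulmxBl.
Qed.

Theorem theorem3p4 (R : realType) (m N : nat) (p : R)
    (mu0 : probability (borel_rV R m) R)
    (Theta : set 'rV[R]_m) (theta : 'I_N -> 'rV[R]_m) :
  1 < p ->
  wasserstein_space p mu0 ->
  mu0 `<< @lebesgue_rV R m ->
  (forall i, Theta (theta i)) ->
  wassmap_recovers p
    (fun i => translate mu0 (theta i) : probability (borel_rV R m) R) theta.
Proof.
move=> p1 Wmu0 _ _; apply: wassmap_recovers_sqdist => i j.
by rewrite wasserstein_translate// sqr_enorm.
Qed.
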